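(* Let $\Sigma$ be a finite poset. The linear map sending $(\sigma_0,\dots,\sigma_k)^\ast$ to $\mu_{(\sigma_0,\dots,\sigma_k)}$ (for all $k\ge1$ and all $\sigma_0\le\dots\le\sigma_k$ in $\Sigma$) induces an isomorphism of (nonsymmetric) operads $$C^\ast(\hat\Sigma)\;\cong\; End_{I_\Sigma,S_\Sigma}(\ast).$$
   Context: $\mathbb K$ is an arbitrary field; $\delta_{x,y}$ is the Kronecker symbol. An operad here is a nonsymmetric operad of $\mathbb K$-vector spaces $\{\mathcal O(k)\}_{k\ge1}$ with associative composition products $\gamma:\mathcal O(k)\otimes\mathcal O(n_1)\otimes\cdots\otimes\mathcal O(n_k)\to\mathcal O(n_1+\cdots+n_k)$ and a unit $1_{\mathcal O}\in\mathcal O(1)$; morphisms of operads are arity-wise linear maps preserving the compositions and the unit. The incidence algebra $I_\Sigma$ is the unital associative $\mathbb K$-algebra with linear basis the pairs $(\sigma,\sigma')$, $\sigma\le\sigma'$ in $\Sigma$, and product $(\sigma,\sigma')(\beta,\beta')=(\sigma,\beta')$ if $\sigma'=\beta$ and $0$ otherwise. $S_\Sigma\subset I_\Sigma$ is the unital subalgebra spanned by the $(\sigma,\sigma)$. $I_\Sigma^{\otimes n}$ (tensor product over $\mathbb K$) is an $S_\Sigma$-bimodule through left multiplication on the first factor and right multiplication on the last factor. $End_{I_\Sigma,S_\Sigma}(n)$ ($n\ge1$) is the space of $S_\Sigma$-bimodule morphisms $I_\Sigma^{\otimes n}\to I_\Sigma$ that factorize through the canonical projection $I_\Sigma^{\otimes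 n}\to I_\Sigma^{\otimes_{S_\Sigma}n}$. With composition of multilinear maps, $\gamma(f;f_1,\dots,f_k)=f\circ(f_1\otimes\cdots\otimes f_k)$, and unit $\mathrm{id}_{I_\Sigma}$, it is an operad. For $\sigma_0\le\dots\le\sigma_n$, $\mu_{(\sigma_0,\dots,\sigma_n)}\in End_{I_\Sigma,S_\Sigma}(n)$ is the map $$(\beta_0,\beta_1)\otimes(\beta_1',\beta_2)\otimes\cdots\otimes(\beta_{n-1}',\beta_n)\mapsto\delta_{\beta_1,\beta_1'}\cdots\delta_{\beta_{n-1},\beta_{n-1}'}\,\delta_{(\beta_0,\dots,\beta_n),(\sigma_0,\dots,\sigma_n)}\,(\sigma_0,\sigma_n).$$ Cochain operad: $\hat\Sigma_n$ is the set of weakly increasing sequences $(\sigma_0\le\dots\le\sigma_n)$ in $\Sigma$, $C^n(\hat\Sigma)$ is the space of functions $\hat\Sigma_n\to\mathbb K$, and $(\sigma_0,\dots,\sigma_n)^\ast\in C^n(\hat\Sigma)$ is the function equal to $1$ on $(\sigma_0,\dots,\sigma_n)$ and $0$ on the other elements of $\hat\Sigma_n$. The operad structure on $C^\ast(\hat\Sigma)=\{C^n(\hat\Sigma)\}_{n\ge1}$ is the multilinear one given, for $f\in C^k(\hat\Sigma)$, $f_j\in C^{n_j}(\hat\Sigma)$ and $N_j:=n_1+\cdots+n_j$ ($N_0=0$), by $$\gamma(f;f_1,\dots,f_k)(\gamma_0,\dots,\gamma_{N_k})=f(\gamma_0,\gamma_{N_1},\dots,\gamma_{N_k})\prod_{j=1}^kf_j(\gamma_{N_{j-1}},\dots,\gamma_{N_j}),$$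 with unit $\sum_{\sigma_0\le\sigma_1}(\sigma_0,\sigma_1)^\ast$. *)

(* Defs.v *)
From HB Require Import structures.
From mathcomp Require Import all_boot all_order all_algebra.
From mathcomp Require Import boolp zify.

Set Implicit Arguments.
Unset Strict Implicit.
Unset Printing Implicit Defensive.

Import Order.TTheory GRing.Theory.
Local Open Scope ring_scope.

(* `dfwith x u` is the family x with its i-th entry replaced by u : V i. *)
Definition multilinear (K : fieldType) (I : eqType) (V : I -> lmodType K)
    (W : lmodType K) (F : (forall i, V i) -> W) : Prop :=
  forall (x : forall i, V i) (i : I) (a : K) (u v : V i),
    F (@dfwith I V x i (a *: u + v)) =
    a *: F (@dfwith I V x i u) + F (@dfwith I V x i v).

Section QuotientModule.
Variables (K : fieldType) (V : vectType K) (A : V -> Prop).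

Definition linspan : {pred V} := fun v =>
  `[< exists2 s : seq V, (forall w, w \in s -> A w) & v \in <<s>>%VS >].

Fact linspan_submod_closed : subsemimod_closed linspan.
Proof.
split; last first.
  move=> a v /asboolP[s sA vs]; apply/asboolP; exists s => //.
  exact: memvZ.
split; first by apply/asboolP; exists [::]; rewrite ?mem0v.
move=> u v /asboolP[s sA us] /asboolP[s' s'A vs']; apply/asboolP.
exists (s ++ s'); first by move=> w; rewrite mem_cat => /orP[/sA|/s'A].
by rewrite span_cat memv_add.
Qed.

HB.instance Definition _ :=
  GRing.isSubmodClosed.Build K V linspan linspan_submod_closed.

Lemma linspan_gen v : A v -> v \in linspan.
Proof.
move=> Av; apply/asboolP; exists [:: v]; first by move=> w /[!inE] /eqP->.
by rewrite span_seq1 memv_line.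
Qed.

Definition quotmod : Type := @Quotient.quot V linspan.
HB.instance Definition _ := GRing.Zmodule.on quotmod.

Definition pi_quotmod (v : V) : quotmod := (\pi_(@Quotient.quot V linspan) v)%qT.

Lemma pi_quotmodD : {morph pi_quotmod : u v / u + v}.
Proof. by move=> u v; rewrite /pi_quotmod [LHS]raddfD. Qed.

Lemma pi_quotmod_eq u v : (pi_quotmod u = pi_quotmod v) <-> (u - v \in linspan).
Proof. by rewrite (Quotient.idealrBE linspan); split=> [/eqP|/eqP]. Qed.

Definition scale_quotmod (a : K) (q : quotmod) : quotmod :=
  pi_quotmod (a *: repr (q : @Quotient.quot V linspan)).

Lemma repr_quotmod (q : quotmod) : pi_quotmod (repr (q : @Quotient.quot V linspan)) = q.
Proof. exact: reprK. Qed.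

Lemma scale_pi_quotmod a v : scale_quotmod a (pi_quotmod v) = pi_quotmod (a *: v).
Proof.
apply/pi_quotmod_eq; rewrite -scalerBr rpredZ//.
by apply/pi_quotmod_eq; rewrite repr_quotmod.
Qed.

Fact scale_quotmodA a b q :
  scale_quotmod a (scale_quotmod b q) = scale_quotmod (a * b) q.
Proof. by rewrite -[q]repr_quotmod !scale_pi_quotmod scalerA. Qed.
Fact scale_quotmod1 : left_id 1 scale_quotmod.
Proof. by move=> q; rewrite -[q]repr_quotmod scale_pi_quotmod scale1r. Qed.
Fact scale_quotmodDr : right_distributive scale_quotmod +%R.
Proof.
move=> a p q; rewrite -[p]repr_quotmod -[q]repr_quotmod.
by rewrite !scale_pi_quotmod -!pi_quotmodD scale_pi_quotmod scalerDr.
Qed.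
Fact scale_quotmodDl q : {morph scale_quotmod^~ q : a b / a + b}.
Proof.
move=> a b; rewrite -[q]repr_quotmod /= !scale_pi_quotmod.
by rewrite -pi_quotmodD scalerDl.
Qed.
HB.instance Definition _ := GRing.Zmodule_isLmodule.Build K quotmod
  scale_quotmodA scale_quotmod1 scale_quotmodDr scale_quotmodDl.

Fact pi_quotmod_linear : linear pi_quotmod.
Proof.
move=> a u v; rewrite pi_quotmodD; congr (_ + _).
by rewrite -[in LHS]scale_pi_quotmod.
Qed.
HB.instance Definition _ :=
  GRing.isLinear.Build K V quotmod *:%R pi_quotmod pi_quotmod_linear.

Lemma quotmod_factorP (W : lmodType K) (f : {linear V -> W}) :
  (exists g : {linear quotmod -> W}, forall v, f v = g (pi_quotmod v)) <->
  (forall v, A v -> f v = 0).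
Proof.
split=> [[g fg] v /linspan_gen Av | f0].
  rewrite fg (_ : pi_quotmod v = 0) ?linear0//.
  by rewrite -(linear0 pi_quotmod); apply/pi_quotmod_eq; rewrite subr0.
have fspan v : v \in linspan -> f v = 0.
  move=> /asboolP[s sA]; rewrite -[s]/(val (in_tuple s)) => /coord_span->.
  rewrite linear_sum big1// => i _.
  by rewrite linearZ_LR f0/= ?scaler0//; apply: sA; apply: mem_nth.
pose g (q : quotmod) : W := f (repr (q : @Quotient.quot V linspan)).
have gpi v : g (pi_quotmod v) = f v.
  apply/eqP; rewrite -subr_eq0 /g -linearB fspan//.
  by apply/pi_quotmod_eq; rewrite repr_quotmod.
have g_lin : linear g.
  move=> a p q; rewrite -[p]repr_quotmod -[q]repr_quotmod.
  by rewrite -linearP !gpi linearP.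
pose gM := GRing.isLinear.Build K quotmod W *:%R g g_lin.
pose gL : {linear quotmod -> W} := HB.pack g gM.
by exists gL => v; rewrite /= gpi.
Qed.

End QuotientModule.

Record arity := Arity { arity_nat :> nat; arity_gt0 : (0 < arity_nat)%N }.
HB.instance Definition _ := [isSub for arity_nat].
HB.instance Definition _ := [Equality of arity by <:].

Definition arity1 : arity := @Arity 1 isT.

Fact asum_gt0 (k : arity) (n : 'I_k -> arity) : (0 < \sum_(i < k) n i)%N.
Proof.
case: k n => k k_gt0 n /=; rewrite (bigD1 (Ordinal k_gt0))//=.
by rewrite addn_gt0 arity_gt0.
Qed.
Definition asum (k : arity) (n : 'I_k -> arity) : arity := Arity (asum_gt0 n).

(* The 'I_(n_1 + ... + n_k) inputs of a composite are cut into consecutive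
   blocks: `block i j` is the j-th input of the i-th block, and input r is the
   `block_pos r`-th input of the `block_of r`-th block. *)
Section Blocks.
Variables (k : arity) (n : 'I_k -> arity).
Definition block (i : 'I_k) (j : 'I_(n i)) : 'I_(asum n) :=
  @tagnat.Rank k (fun i => n i) i j.
Definition block_of (r : 'I_(asum n)) : 'I_k :=
  @tagnat.sig1 k (fun i => n i) r.
Definition block_pos (r : 'I_(asum n)) : 'I_(n (block_of r)) :=
  @tagnat.sig2 k (fun i => n i) r.
End Blocks.

(* The two sides of the associativity and unit laws live in arities that are
   equal but not convertible, hence equality in the sigma type {N & O N}. *)
Record operad (K : fieldType) := Operad {
  op_car :> arity -> lmodType K;
  op_comp : forall (k : arity) (n : 'I_k -> arity),
    op_car k -> (forall i, op_car (n i)) -> op_car (asum n);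
  op_unit : op_car arity1;
  op_comp_linearl : forall (k : arity) (n : 'I_k -> arity)
    (g : forall i, op_car (n i)), linear (fun f => op_comp f g);
  op_comp_linearr : forall (k : arity) (n : 'I_k -> arity) (f : op_car k),
    multilinear (V := fun i => op_car (n i)) (op_comp f);
  op_compA : forall (k : arity) (n : 'I_k -> arity)
    (m : forall i : 'I_k, 'I_(n i) -> arity) (f : op_car k)
    (g : forall i, op_car (n i)) (h : forall i j, op_car (m i j)),
    existT op_car _
      (op_comp (op_comp f g) (fun r => h (block_of r) (block_pos r))) =
    existT op_car _ (op_comp f (fun i => op_comp (g i) (h i)));
  op_comp1l : forall (n : arity) (f : op_car n),
    existT op_car _ (op_comp op_unit (fun _ : 'I_arity1 => f)) =
    existT op_car n f;
  op_comp1r : forall (k : arity) (f : op_car k),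
    existT op_car _ (op_comp f (fun _ : 'I_k => op_unit)) =
    existT op_car k f
}.

Record operad_morphism (K : fieldType) (P Q : operad K) := OperadMorphism {
  opm_fun :> forall n : arity, {linear P n -> Q n};
  opm_comp : forall (k : arity) (n : 'I_k -> arity) (f : P k)
    (g : forall i, P (n i)),
    opm_fun (asum n) (op_comp f g) =
    op_comp (opm_fun k f) (fun i => opm_fun (n i) (g i));
  opm_unit : opm_fun arity1 (op_unit P) = op_unit Q
}.

Definition operad_isomorphism (K : fieldType) (P Q : operad K)
    (phi : operad_morphism P Q) : Prop :=
  exists psi : operad_morphism Q P,
    forall n : arity, cancel (phi n) (psi n) /\ cancel (psi n) (phi n).

(* N_i = n_0 + ... + n_{i-1}, with the inputs numbered from 0. *)
Definition psum (k : nat) (n : 'I_k -> arity) (i : nat) : nat :=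
  (\sum_(j < k | (j < i)%N) n j)%N.

Section BlockTheory.
Variables (k : arity) (n : 'I_k -> arity).

Lemma val_block (i : 'I_k) (j : 'I_(n i)) : block j = (psum n i + j)%N :> nat.
Proof. exact: tagnat.RankEsum. Qed.

Lemma psum0 : psum n 0 = 0%N.
Proof. by rewrite /psum big_pred0. Qed.

Lemma psumS (i : 'I_k) : psum n i.+1 = (psum n i + n i)%N.
Proof.
rewrite /psum (bigD1 i) ?ltnSn//= addnC; congr (_ + _)%N; apply: eq_bigl => j.
by rewrite ltnS ltn_neqAle andbC.
Qed.

Lemma psum_max : psum n k = asum n.
Proof. by apply: eq_bigl => j; rewrite ltn_ord. Qed.

Lemma leq_psum : {homo psum n : i j / (i <= j)%N}.
Proof.
move=> i j ij; rewrite /psum [leqRHS](bigID (fun l : 'I_k => (l < i)%N))/=.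
rewrite (_ : \sum_(_ < _ | _ && _) _ = psum n i)%N ?leq_addr//.
apply: eq_bigl => l; case: (ltnP l i) => [li|]; rewrite ?andbF//.
by rewrite (leq_trans li ij).
Qed.

Lemma psum_block_le (i : 'I_k) (l : nat) :
  (l <= n i)%N -> (psum n i + l <= asum n)%N.
Proof.
move=> ln; rewrite -psum_max; apply: leq_trans (leq_psum (ltn_ord i)).
by rewrite psumS leq_add2l.
Qed.

End BlockTheory.

Section IncidenceAlgebra.
Variables (K : fieldType) (d : Order.disp_t) (T : finPOrderType d).

Definition interval : Type := {p : T * T | (p.1 <= p.2)%O}.
HB.instance Definition _ := SubFinite.on interval.

Definition mkinterval (x y : T) (xy : (x <= y)%O) : interval :=
  exist (fun p : T * T => (p.1 <= p.2)%O) (x, y) xy.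

(* An alias, so as not to inherit the pointwise product of {ffun _ -> _}. *)
Definition incalg : Type := {ffun interval -> K^o}.
HB.instance Definition _ := Vector.on incalg.

Definition ibase (p : interval) : incalg := [ffun q => (q == p)%:R].

Definition ibase_mul (p q : interval) : incalg :=
  [ffun r : interval =>
     (((val p).2 == (val q).1) && (val r == ((val p).1, (val q).2)))%:R].

Definition incalg_mul (x y : incalg) : incalg :=
  \sum_p \sum_q (x p * y q) *: ibase_mul p q.

Definition incalg_one : incalg := \sum_(s : T) ibase (mkinterval (lexx s)).

Implicit Types (x y z : incalg) (p q : interval).

(* The coefficients extended by 0 to pairs x, y with x </= y. *)
Definition icoef (x : incalg) (a b : T) : K :=
  if insub (a, b) is Some p then x p else 0.

Lemma icoef_val x (p : interval) : x p = icoef x (val p).1 (val p).2.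
Proof. by rewrite /icoef -surjective_pairing valK. Qed.

Lemma icoefP x y : (forall a b, icoef x a b = icoef y a b) -> x = y.
Proof. by move=> xy; apply/ffunP => p; rewrite !icoef_val. Qed.

Lemma icoefE x a b : icoef x a b = \sum_p x p * (val p == (a, b))%:R.
Proof.
rewrite /icoef; case: insubP => [p _ pab|abN].
  rewrite (bigD1 p)//= pab eqxx mulr1 big1 ?addr0// => q qp.
  by rewrite -pab (inj_eq val_inj) (negPf qp) mulr0.
rewrite big1// => p _; case: eqP => [pab|]; last by rewrite mulr0.
by rewrite -pab (valP p) in abN.
Qed.

Lemma icoefD x y a b : icoef (x + y) a b = icoef x a b + icoef y a b.
Proof. by rewrite /icoef; case: insub => [p|]; rewrite ?ffunE ?addr0. Qed.

Lemma icoefZ k x a b : icoef (k *: x) a b = k * icoef x a b.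
Proof. by rewrite /icoef; case: insub => [p|]; rewrite ?ffunE ?mulr0. Qed.

Lemma icoef_sum (I : Type) (r : seq I) (P : pred I) (F : I -> incalg) a b :
  icoef (\sum_(i <- r | P i) F i) a b = \sum_(i <- r | P i) icoef (F i) a b.
Proof.
elim/big_rec2: _ => [|i u v _ <-]; last by rewrite icoefD.
by rewrite /icoef; case: insub => [p|]; rewrite ?ffunE.
Qed.

Lemma icoef_base p a b : icoef (ibase p) a b = (val p == (a, b))%:R.
Proof.
rewrite /icoef; case: insubP => [q _ <-|]; first by rewrite ffunE -val_eqE eq_sym.
by case: eqP => // <-; rewrite (valP p).
Qed.

Lemma icoef_base_mul p q a b : icoef (ibase_mul p q) a b =
  \sum_s (val p == (a, s))%:R * (val q == (s, b))%:R.
Proof.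
case: p q => [[p1 p2] /= p12] [[q1 q2] /= q12].
transitivity (((p2 == q1) && ((a, b) == (p1, q2)))%:R : K).
  rewrite /icoef; case: insubP => [r _ rab|]; first by rewrite ffunE /= rab.
  by case: eqP => //= pq; case: eqP => // -[-> ->]; rewrite (le_trans p12)// pq.
rewrite (bigD1 p2)//= big1 => [|s sp]; last first.
  by rewrite xpair_eqE (eq_sym p2) (negPf sp) andbF mul0r.
rewrite addr0 !xpair_eqE eqxx andbT -natrM mulnb; congr (_%:R).
by rewrite (eq_sym a) (eq_sym b) (eq_sym q1) andbCA andbA.
Qed.

Lemma icoef_mul x y a b :
  icoef (incalg_mul x y) a b = \sum_s icoef x a s * icoef y s b.
Proof.
rewrite icoef_sum; under eq_bigr do rewrite icoef_sum.
transitivity (\sum_p \sum_q \sum_s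
    (x p * (val p == (a, s))%:R) * (y q * (val q == (s, b))%:R)).
  apply: eq_bigr => p _; apply: eq_bigr => q _.
  rewrite icoefZ icoef_base_mul mulr_sumr; apply: eq_bigr => s _.
  by rewrite mulrACA.
under eq_bigr do rewrite exchange_big/=.
rewrite exchange_big/=; apply: eq_bigr => s _.
rewrite !icoefE mulr_suml; apply: eq_bigr => p _.
by rewrite mulr_sumr.
Qed.

Lemma icoef_one a b : icoef incalg_one a b = (a == b)%:R.
Proof.
rewrite icoef_sum (bigD1 a)//= big1 ?addr0 => [|s sa]; rewrite icoef_base /=.
  by rewrite xpair_eqE eqxx.
by rewrite xpair_eqE (negPf sa).
Qed.

Fact incalg_mulA : associative incalg_mul.
Proof.
move=> x y z; apply: icoefP => a b; rewrite !icoef_mul.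
under eq_bigr do rewrite icoef_mul mulr_sumr.
rewrite exchange_big; apply: eq_bigr => s _ /=; rewrite icoef_mul mulr_suml.
by apply: eq_bigr => t _; rewrite mulrA.
Qed.
Fact incalg_mul1 : left_id incalg_one incalg_mul.
Proof.
move=> x; apply: icoefP => a b; rewrite icoef_mul (bigD1 a)//= icoef_one eqxx.
by rewrite mul1r big1 ?addr0// => s sa; rewrite icoef_one eq_sym (negPf sa) mul0r.
Qed.
Fact incalg_1mul : right_id incalg_one incalg_mul.
Proof.
move=> x; apply: icoefP => a b; rewrite icoef_mul (bigD1 b)//= icoef_one eqxx.
by rewrite mulr1 big1 ?addr0// => s sb; rewrite icoef_one (negPf sb) mulr0.
Qed.
Fact incalg_mulDl : left_distributive incalg_mul +%R.
Proof.
move=> x y z; apply: icoefP => a b; rewrite icoefD !icoef_mul -big_split/=.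
by apply: eq_bigr => s _; rewrite icoefD mulrDl.
Qed.
Fact incalg_mulDr : right_distributive incalg_mul +%R.
Proof.
move=> x y z; apply: icoefP => a b; rewrite icoefD !icoef_mul -big_split/=.
by apply: eq_bigr => s _; rewrite icoefD mulrDr.
Qed.
HB.instance Definition _ := GRing.Zmodule_isPzRing.Build incalg
  incalg_mulA incalg_mul1 incalg_1mul incalg_mulDl incalg_mulDr.

(* The MathComp algebra structures require 1 != 0, which fails for empty T. *)
Lemma incalg_scaleAl k (x y : incalg) : k *: (x * y) = (k *: x) * y.
Proof.
apply: icoefP => a b; rewrite icoefZ !icoef_mul mulr_sumr.
by apply: eq_bigr => s _; rewrite icoefZ mulrA.
Qed.
Lemma incalg_scaleAr k (x y : incalg) : k *: (x * y) = x * (k *: y).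
Proof.
apply: icoefP => a b; rewrite icoefZ !icoef_mul mulr_sumr.
by apply: eq_bigr => s _; rewrite icoefZ mulrCA.
Qed.

Lemma ibaseM p q : ibase p * ibase q = ibase_mul p q.
Proof.
apply: icoefP => a b; rewrite icoef_mul icoef_base_mul.
by apply: eq_bigr => s _; rewrite !icoef_base.
Qed.

Lemma incalg_sum_base (x : incalg) : x = \sum_p x p *: ibase p.
Proof.
apply: icoefP => a b; rewrite icoef_sum icoefE.
by apply: eq_bigr => p _; rewrite icoefZ icoef_base.
Qed.

Definition diagalg : {vspace incalg} :=
  <<[seq ibase (mkinterval (lexx s)) | s <- enum T]>>%VS.

Lemma diagalg_coef s a b : s \in diagalg -> a != b -> icoef s a b = 0.
Proof.
move=> + ab; rewrite /diagalg -[map _ _]/(val (in_tuple _)) => /coord_span->.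
rewrite icoef_sum big1// => i _; rewrite icoefZ.
have /mapP[t _ ->] := mem_nth 0 (ltn_ord i : (i < size (in_tuple _))%N).
rewrite icoef_base /= xpair_eqE.
by case: eqP => [->|_]; rewrite ?(negPf ab) ?mulr0.
Qed.

Lemma mul_diagl s x a b : s \in diagalg ->
  icoef (s * x) a b = icoef s a a * icoef x a b.
Proof.
move=> sS; rewrite icoef_mul (bigD1 a)//= big1 ?addr0// => t ta.
by rewrite (diagalg_coef sS) ?mul0r// eq_sym.
Qed.

Lemma mul_diagr s x a b : s \in diagalg ->
  icoef (x * s) a b = icoef x a b * icoef s b b.
Proof.
move=> sS; rewrite icoef_mul (bigD1 b)//= big1 ?addr0// => t tb.
by rewrite (diagalg_coef sS) ?mulr0.
Qed.

End IncidenceAlgebra.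

Arguments ibase K {d T} p.
Arguments diagalg K {d} T.

Section TensorPower.
Variables (K : fieldType) (d : Order.disp_t) (T : finPOrderType d).
Local Notation I := (incalg K T).
Local Notation upd x i u := (@dfwith _ (fun _ => I) x i u).

Lemma updE (n : nat) (x : 'I_n -> I) (i : 'I_n) (u : I) (j : 'I_n) :
  upd x i u j = if j == i then u else x j.
Proof.
case: eqP => [->|/eqP ji]; first by rewrite dfwith_in.
by rewrite dfwith_out// eq_sym.
Qed.

(* The n-th tensor power of the incidence algebra over K, through its basis
   ibase p_1 (x) ... (x) ibase p_n; `pure x` is x_1 (x) ... (x) x_n. *)
Definition tens (n : nat) : Type := {ffun {ffun 'I_n -> interval T} -> K^o}.
HB.instance Definition _ n := Vector.on (tens n).

Definition pure n (x : 'I_n -> I) : tens n :=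
  [ffun b : {ffun 'I_n -> interval T} => \prod_i x i (b i)].

Definition tbase_lift n (W : lmodType K)
    (F : {ffun 'I_n -> interval T} -> W) (t : tens n) : W :=
  \sum_(b : {ffun 'I_n -> interval T}) t b *: F b.

Fact tbase_lift_linear n (W : lmodType K)
  (F : {ffun 'I_n -> interval T} -> W) : linear (tbase_lift F).
Proof.
move=> a u v; rewrite /tbase_lift scaler_sumr -big_split.
by apply: eq_bigr => b _ /=; rewrite scalerA -scalerDl !ffunE.
Qed.
HB.instance Definition _ n (W : lmodType K)
    (F : {ffun 'I_n -> interval T} -> W) :=
  GRing.isLinear.Build K (tens n) W *:%R (tbase_lift F) (tbase_lift_linear F).

(* The linear map on tensors induced by a multilinear map F, see tlift_pure. *)
Definition tlift n (W : lmodType K) (F : ('I_n -> I) -> W) : tens n -> W :=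
  tbase_lift (fun b => F (fun i => ibase K (b i))).
HB.instance Definition _ n (W : lmodType K) (F : ('I_n -> I) -> W) :=
  GRing.Linear.on (tlift F).

Definition tmultilinear n (W : lmodType K) (F : ('I_n -> I) -> W) : Prop :=
  multilinear (V := fun _ : 'I_n => I) F.

Lemma pure_upd n (x : 'I_n -> I) i u b :
  pure (upd x i u) b = u (b i) * \prod_(j | j != i) x j (b j).
Proof.
rewrite ffunE (bigD1 i)//= updE eqxx; congr (_ * _).
by apply: eq_bigr => j ji; rewrite updE (negPf ji).
Qed.

Lemma pure_multilinear n : tmultilinear (@pure n).
Proof.
move=> x i a u v; apply/ffunP => b.
transitivity (a * pure (upd x i u) b + pure (upd x i v) b); last first.
  by rewrite !ffunE.
by rewrite !pure_upd !ffunE mulrDl mulrA.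
Qed.

Lemma tmultilinear_expand n (W : lmodType K) (F : ('I_n -> I) -> W) x i :
  tmultilinear F ->
  F x = \sum_p x i p *: F (upd x i (ibase K p)).
Proof.
move=> FM.
have F0 : F (upd x i 0) = 0.
  have := FM x i (-1) 0 0.
  by rewrite scaleN1r oppr0 addr0 scaleN1r addNr.
have FD u v : F (upd x i (u + v)) =
    F (upd x i u) + F (upd x i v).
  by have := FM x i 1 u v; rewrite !scale1r.
have FZ a u : F (upd x i (a *: u)) =
    a *: F (upd x i u).
  by have := FM x i a u 0; rewrite addr0 F0 addr0.
transitivity (F (upd x i (\sum_p x i p *: ibase K p))).
  congr F; apply/funext => j; rewrite updE -incalg_sum_base.
  by case: eqP => // ->.
rewrite (big_morph (fun u => F (upd x i u)) FD F0).
by apply: eq_bigr => p _; rewrite FZ.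
Qed.

Lemma tlift_pure n (W : lmodType K) (F : ('I_n -> I) -> W) x :
  tmultilinear F -> tlift F (pure x) = F x.
Proof.
move=> FM.
suff H s (y : 'I_n -> I) : uniq s ->
    (forall i, i \notin s -> exists p, y i = ibase K p) ->
    tlift F (pure y) = F y.
  by apply: (H (enum 'I_n)); rewrite ?enum_uniq// => i; rewrite mem_enum.
elim: s y => [|i s IH] y /=.
  move=> _ yb; have [c yc] : exists c : {ffun 'I_n -> interval T},
      y = fun i => ibase K (c i).
    have {}yb i := cid (yb i isT).
    by exists [ffun i => sval (yb i)]; apply/funext => i; rewrite ffunE; case: (yb i).
  rewrite {}yc /tlift /tbase_lift (bigD1 c)//= [X in _ + X]big1 ?addr0 => [|b bc].
    by rewrite ffunE big1 ?scale1r// => i _; rewrite ffunE eqxx.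
  rewrite ffunE; have /fintype.forallPn[j bj] : ~~ [forall j, b j == c j].
    by apply: contra bc => /eqfunP bc; apply/eqP/ffunP.
  by rewrite (bigD1 j)//= ffunE (negPf bj) mul0r scale0r.
move=> /andP[si us] yb.
rewrite (tmultilinear_expand y i FM) (tmultilinear_expand y i (@pure_multilinear n)).
rewrite linear_sum; apply: eq_bigr => p _; rewrite linearZ/=; congr (_ *: _).
apply: IH => // j js; rewrite updE; case: eqP => [_|/eqP ji]; first by exists p.
by apply: yb; rewrite inE (negPf ji).
Qed.

Lemma tens_ext n (W : lmodType K) (f g : {linear tens n -> W}) :
  (forall x, f (pure x) = g (pure x)) -> f =1 g.
Proof.
move=> fg t; have -> : t = tlift (@pure n) t.
  apply/ffunP => c; rewrite /tlift /tbase_lift sum_ffunE (bigD1 c)//= big1 => [|b bc].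
    rewrite !ffunE big1 => [|i _]; last by rewrite ffunE eqxx.
    by rewrite [_ *: _]mulr1 addr0.
  have /fintype.forallPn[j bj] : ~~ [forall j, b j == c j].
    by apply: contra bc => /eqfunP bc; apply/eqP/ffunP.
  by rewrite !ffunE (bigD1 j)//= ffunE eq_sym (negPf bj) mul0r scaler0.
by rewrite !linear_sum; apply: eq_bigr => b _; rewrite !linearZ/= fg.
Qed.

Section Bimodule.
Variable n : arity.

Definition tfirst : 'I_n := Ordinal (arity_gt0 n).
Definition tlast : 'I_n := rev_ord tfirst.

Definition tact (i : 'I_n) (h : I -> I) : tens n -> tens n :=
  tlift (fun x => pure (upd x i (h (x i)))).
HB.instance Definition _ i h := GRing.Linear.on (tact i h).

(* s . (x_1 (x) ... (x) x_n) and (x_1 (x) ... (x) x_n) . s *)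
Definition tlmul (s : I) : tens n -> tens n := tact tfirst (fun y => s * y).
Definition trmul (s : I) : tens n -> tens n := tact tlast (fun y => y * s).
HB.instance Definition _ s := GRing.Linear.on (tlmul s).
HB.instance Definition _ s := GRing.Linear.on (trmul s).
End Bimodule.

(* The differences x_1 (x) ... (x) x_i s (x) x_{i+1} (x) ... (x) x_n
   - x_1 (x) ... (x) x_i (x) s x_{i+1} (x) ... (x) x_n, for s in the
   subalgebra S = diagalg: their span is the kernel of the projection from the
   n-th tensor power over K to the one over S. *)
Definition balancing (n : nat) (t : tens n) : Prop :=
  exists (i j : 'I_n) (x : 'I_n -> I) (s : I),
    [/\ j = i.+1 :> nat, s \in diagalg K T &
        t = pure (upd x i (x i * s))
          - pure (upd x j (s * x j))].

Definition tensS (n : nat) : lmodType K := quotmod (@balancing n).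
Definition pi_tensS (n : nat) : {linear tens n -> tensS n} :=
  @pi_quotmod K (tens n) (@balancing n).

Definition bimodule_morphism (n : arity) (f : tens n -> I) : Prop :=
  forall (s : I) (t : tens n), s \in diagalg K T ->
    f (tlmul s t) = s * f t /\ f (trmul s t) = f t * s.

Definition factors_tensS (n : nat) (f : tens n -> I) : Prop :=
  exists g : {linear tensS n -> I}, forall t, f t = g (pi_tensS n t).

Definition imull (s y : I) : I := s * y.
Definition imulr (s y : I) : I := y * s.
Fact imull_linear s : linear (imull s).
Proof. by move=> a u v; rewrite /imull mulrDr incalg_scaleAr. Qed.
Fact imulr_linear s : linear (imulr s).
Proof. by move=> a u v; rewrite /imulr mulrDl incalg_scaleAl. Qed.
HB.instance Definition _ s :=
  GRing.isLinear.Build K I I *:%R (imull s) (imull_linear s).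
HB.instance Definition _ s :=
  GRing.isLinear.Build K I I *:%R (imulr s) (imulr_linear s).

Lemma upd_upd n (x : 'I_n -> I) i u v : upd (upd x i u) i v = upd x i v.
Proof. by apply/funext => j; rewrite !updE; case: eqP. Qed.

Lemma upd_updC n (x : 'I_n -> I) i j u v : i != j ->
  upd (upd x i u) j v = upd (upd x j v) i u.
Proof.
move=> ij; apply/funext => l; rewrite !updE; case: eqP => // ->.
by rewrite eq_sym (negPf ij).
Qed.

Lemma tact_pure (n : arity) (i : 'I_n) (h : {linear I -> I}) x :
  tact i h (pure x) = pure (upd x i (h (x i))).
Proof.
apply: (tlift_pure x (F := fun x => pure (upd x i (h (x i))))) => {}x j a u v.
have [->|ij] := eqVneq i j.
  by rewrite !upd_upd !updE eqxx linearP pure_multilinear.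
by rewrite !updE (negPf ij) !(upd_updC _ _ _ (_ : j != i)) 1?eq_sym// pure_multilinear.
Qed.

Lemma tlmul_pure (n : arity) s (x : 'I_n -> I) :
  tlmul s (pure x) = pure (upd x (tfirst n) (s * x (tfirst n))).
Proof. exact: (tact_pure _ (imull s)). Qed.

Lemma trmul_pure (n : arity) s (x : 'I_n -> I) :
  trmul s (pure x) = pure (upd x (tlast n) (x (tlast n) * s)).
Proof. exact: (tact_pure _ (imulr s)). Qed.

Lemma bimodule_morphismP (n : arity) (f : {linear tens n -> I}) :
  bimodule_morphism f <-> forall s x, s \in diagalg K T ->
    f (pure (upd x (tfirst n) (s * x (tfirst n)))) = s * f (pure x) /\
    f (pure (upd x (tlast n) (x (tlast n) * s))) = f (pure x) * s.
Proof.
split=> [fM s x /(fM s (pure x))|fM s t sS].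
  by rewrite tlmul_pure trmul_pure.
split.
- apply: (tens_ext (f := f \o tlmul s) (g := imull s \o f)) => x /=.
  by rewrite tlmul_pure (fM s x sS).1.
- apply: (tens_ext (f := f \o trmul s) (g := imulr s \o f)) => x /=.
  by rewrite trmul_pure (fM s x sS).2.
Qed.

Lemma factors_tensSP n (f : {linear tens n -> I}) : factors_tensS f <->
  forall (i j : 'I_n) x s, j = i.+1 :> nat -> s \in diagalg K T ->
    f (pure (upd x i (x i * s))) = f (pure (upd x j (s * x j))).
Proof.
split=> [/quotmod_factorP f0 i j x s ij sS|fb].
  by apply/eqP; rewrite -subr_eq0 -linearB; apply/eqP/f0; exists i, j, x, s.
apply/quotmod_factorP => t [i [j [x [s [ij sS ->]]]]].
by rewrite linearB/= (fb i j)// subrr.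
Qed.

End TensorPower.

Section EndomorphismOperad.
Variables (K : fieldType) (d : Order.disp_t) (T : finPOrderType d).
Local Notation I := (incalg K T).
Local Notation upd x i u := (@dfwith _ (fun _ => I) x i u).

Definition is_endop (n : arity) : {pred 'Hom(tens K T n, I)} := fun f =>
  `[< bimodule_morphism f /\ factors_tensS f >].

Lemma is_endopP (n : arity) (f : 'Hom(tens K T n, I)) : f \in @is_endop n <->
  (forall s x, s \in diagalg K T ->
    f (pure (upd x (tfirst n) (s * x (tfirst n)))) = s * f (pure x) /\
    f (pure (upd x (tlast n) (x (tlast n) * s))) = f (pure x) * s) /\
  (forall (i j : 'I_n) x s, j = i.+1 :> nat -> s \in diagalg K T ->
    f (pure (upd x i (x i * s))) = f (pure (upd x j (s * x j)))).
Proof.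
split=> [/asboolP[/bimodule_morphismP fM /factors_tensSP fF]|[fM fF]].
  by split.
by apply/asboolP; split; [exact/bimodule_morphismP|exact/factors_tensSP].
Qed.

Fact is_endop_submod_closed n : subsemimod_closed (@is_endop n).
Proof.
split; [split|].
- apply/is_endopP; split=> [s x sS|i j x s ij sS]; rewrite !zero_lfunE//.
  by rewrite mulr0 mul0r.
- move=> f g /is_endopP[fM fF] /is_endopP[gM gF].
  apply/is_endopP; split=> [s x sS|i j x s ij sS]; rewrite !add_lfunE.
    rewrite (fM s x sS).1 (fM s x sS).2.
    by rewrite (gM s x sS).1 (gM s x sS).2 mulrDl mulrDr.
  by rewrite (fF i j)// (gF i j).
- move=> a f /is_endopP[fM fF].
  apply/is_endopP; split=> [s x sS|i j x s ij sS]; rewrite !scale_lfunE.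
    rewrite (fM s x sS).1 (fM s x sS).2.
    by rewrite -incalg_scaleAl -incalg_scaleAr.
  by rewrite (fF i j).
Qed.
HB.instance Definition _ (n : arity) := GRing.isSubmodClosed.Build K
  'Hom(tens K T n, I) (@is_endop n) (@is_endop_submod_closed n).

Record endop (n : arity) := EndOp {
  endop_hom :> 'Hom(tens K T n, I);
  endop_in : endop_hom \in @is_endop n
}.
HB.instance Definition _ (n : arity) := [isSub for @endop_hom n].
HB.instance Definition _ (n : arity) := [Choice of endop n by <:].
HB.instance Definition _ (n : arity) := [SubChoice_isSubLmodule of endop n by <:].

Lemma endop_mul (n : arity) (f : endop n) s x : s \in diagalg K T ->
  f (pure (upd x (tfirst n) (s * x (tfirst n)))) = s * f (pure x) /\
  f (pure (upd x (tlast n) (x (tlast n) * s))) = f (pure x) * s.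
Proof. by have /is_endopP[+ _] := endop_in f; apply. Qed.

Lemma endop_bal (n : arity) (f : endop n) (i j : 'I_n) x s :
  j = i.+1 :> nat -> s \in diagalg K T ->
  f (pure (upd x i (x i * s))) = f (pure (upd x j (s * x j))).
Proof. by have /is_endopP[_ +] := endop_in f; apply. Qed.

Lemma endop_ext (n : arity) (f g : endop n) : (forall x, f (pure x) = g (pure x)) -> f = g.
Proof. by move=> fg; apply/val_inj/lfunP; apply: tens_ext. Qed.

Section Composition.
Variables (k : arity) (n : 'I_k -> arity).

Definition subfamily (x : 'I_(asum n) -> I) (i : 'I_k) : 'I_(n i) -> I :=
  fun j => x (block j).

(* g_1 (x) ... (x) g_k, as a map to the k-th tensor power *)
Definition tens_maps (g : forall i, 'Hom(tens K T (n i), I)) :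
    tens K T (asum n) -> tens K T k :=
  tlift (fun x => pure (fun i => g i (pure (subfamily x (i := i))))).
HB.instance Definition _ g := GRing.Linear.on (tens_maps g).

Definition endop_comp_hom (f : 'Hom(tens K T k, I))
    (g : forall i, 'Hom(tens K T (n i), I)) : 'Hom(tens K T (asum n), I) :=
  linfun (f \o tens_maps g).

Lemma blockP (r : 'I_(asum n)) : exists i (j : 'I_(n i)), r = block j.
Proof.
by exists (block_of r), (block_pos r); rewrite /block [RHS]tagnat.sig2K.
Qed.

Lemma block_inj i : injective (@block k n i).
Proof.
move=> j j' /(congr1 (@nat_of_ord _)); rewrite !val_block => /addnI.
exact: val_inj.
Qed.

Lemma block_neq i i' (j : 'I_(n i)) (j' : 'I_(n i')) :
  i != i' -> block j != block j'.
Proof.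
move=> ii'; have := @tagnat.eq_Rank k (fun i => n i) i i' j j'.
by rewrite (negPf ii') /= => /negbT.
Qed.

Lemma subfamily_upd x i (j : 'I_(n i)) u :
  subfamily (upd x (block j) u) (i := i) = upd (subfamily x (i := i)) j u.
Proof.
by apply/funext => j'; rewrite /subfamily !updE (inj_eq (@block_inj _)).
Qed.

Lemma subfamily_updN x i i' (j : 'I_(n i)) u : i' != i ->
  subfamily (upd x (block j) u) (i := i') = subfamily x (i := i').
Proof.
by move=> ii'; apply/funext => j'; rewrite /subfamily updE (negPf (block_neq _ _ ii')).
Qed.

Lemma subfamilies_upd g x i (j : 'I_(n i)) u :
  (fun i' => (g i' : 'Hom(_, I)) (pure (subfamily (upd x (block j) u) (i := i')))) =
  upd (fun i' => g i' (pure (subfamily x (i := i')))) i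
      (g i (pure (upd (subfamily x (i := i)) j u))).
Proof.
apply/funext => i'; rewrite updE; case: eqP => [->|/eqP ii'].
  by rewrite subfamily_upd.
by rewrite subfamily_updN.
Qed.

Lemma tens_maps_pure g x : tens_maps g (pure x) =
  pure (fun i => g i (pure (subfamily x (i := i)))).
Proof.
apply: (tlift_pure x
  (F := fun x => pure (fun i => g i (pure (subfamily x (i := i)))))).
move=> {}x r a u v; have [i [j ->]] := blockP r.
by rewrite !subfamilies_upd pure_multilinear linearP pure_multilinear.
Qed.

Lemma endop_comp_pure f g x : endop_comp_hom f g (pure x) =
  f (pure (fun i => g i (pure (subfamily x (i := i))))).
Proof. by rewrite lfunE /= tens_maps_pure. Qed.

Lemma block_first : tfirst (asum n) = block (tfirst (n (tfirst k))).
Proof. by apply: ord_inj; rewrite val_block /= psum0. Qed.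

Lemma block_last : tlast (asum n) = block (tlast (n (tlast k))).
Proof.
apply: ord_inj; rewrite val_block /= !subn1.
have := psumS n (tlast k); rewrite /= subn1 prednK ?arity_gt0// psum_max /= => ->.
by have := arity_gt0 (n (tlast k)); lia.
Qed.

Lemma block_succ i (j : 'I_(n i)) (r : 'I_(asum n)) :
  r = (block j).+1 :> nat ->
  (exists2 j' : 'I_(n i), r = block j' & j' = j.+1 :> nat) \/
  (exists2 i' : 'I_k, i' = i.+1 :> nat &
     j = tlast (n i) /\ r = block (tfirst (n i'))).
Proof.
rewrite val_block => rE; have [jn|] := ltnP j.+1 (n i).
  left; exists (Ordinal jn) => //; apply: ord_inj.
  by rewrite val_block rE /= addnS.
move=> jn; have jE : j.+1 = n i by apply/eqP; rewrite eqn_leq jn ltn_ord.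
have rS : r = psum n i.+1 :> nat by rewrite psumS rE; lia.
have ik : (i.+1 < k)%N.
  rewrite ltnNge; apply/negP => /(leq_psum n); rewrite psum_max -rS.
  by rewrite leqNgt ltn_ord.
right; exists (Ordinal ik) => //; split; apply: ord_inj.
  by rewrite /=; lia.
by rewrite val_block rS addn0.
Qed.

Fact endop_comp_subproof (f : endop k) (g : forall i, endop (n i)) :
  endop_comp_hom f g \in @is_endop (asum n).
Proof.
apply/is_endopP; split=> [s x sS|r r' x s rr' sS].
  rewrite !endop_comp_pure block_first block_last !subfamilies_upd.
  set y := fun i => endop_hom (g i) (pure (subfamily x (i := i))).
  split.
    by have [<- _] := endop_mul f y sS; rewrite (endop_mul (g _) _ sS).1.
  by have [_ <-] := endop_mul f y sS; rewrite (endop_mul (g _) _ sS).2.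
rewrite !endop_comp_pure.
set y := fun i => endop_hom (g i) (pure (subfamily x (i := i))).
have [i [j rE]] := blockP r; rewrite rE in rr' *.
have [[j' -> jj']|[i' ii' [-> ->]]] := block_succ rr'; rewrite !subfamilies_upd.
  congr (f (pure _)); congr (upd _ _ _).
  by rewrite (endop_bal (g i) (subfamily x (i := i)) jj').
rewrite (endop_mul (g i) (subfamily x (i := i)) sS).2.
rewrite (endop_mul (g i') (subfamily x (i := i')) sS).1.
exact: (endop_bal f y ii').
Qed.

Definition endop_comp (f : endop k) (g : forall i, endop (n i)) :
  endop (asum n) := EndOp (endop_comp_subproof f g).

End Composition.

Lemma endop_compE (k : arity) (n : 'I_k -> arity) (f : endop k)
    (g : forall i, endop (n i)) x :
  endop_comp f g (pure x) = f (pure (fun i => g i (pure (fun j => x (block j))))).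
Proof. exact: endop_comp_pure. Qed.

End EndomorphismOperad.

Section IteratedBlocks.
Variables (k : arity) (n : 'I_k -> arity).

Lemma block_ind (Q : forall i, 'I_(n i) -> Prop) i (j : 'I_(n i)) :
  Q i j -> Q (block_of (block j)) (block_pos (block j)).
Proof.
pose Q' (s : {i & 'I_(n i)}) := Q (tag s) (tagged s).
rewrite -/(Q' (Tagged (fun i => 'I_(n i)) j)).
have -> : Tagged (fun i => 'I_(n i)) j = tagnat.sig (block j).
  by rewrite /block /tagnat.Rank tagnat.rankK.
by [].
Qed.

Lemma big_block (R : Type) (idx : R) (op : Monoid.com_law idx)
    (P : pred 'I_(asum n)) (F : 'I_(asum n) -> R) :
  \big[op/idx]_(r : 'I_(asum n) | P r) F r =
  \big[op/idx]_(i < k) \big[op/idx]_(j < n i | P (block j)) F (block j).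
Proof.
rewrite (reindex (@tagnat.rank k (fun i => n i))); last first.
  by exists (@tagnat.sig k (fun i => n i)) => s _; rewrite ?tagnat.sigK ?tagnat.rankK.
rewrite (@sig_big_dep _ _ _ _ (fun i => 'I_(n i)) xpredT
  (fun i j => P (block j)) (fun i j => F (block j))) /=.
by apply: eq_big => [] [i j].
Qed.

Lemma ltn_block i (j : 'I_(n i)) i' (j' : 'I_(n i')) :
  (block j' < block j)%N = (i' < i)%N || ((i' == i) && (j' < j)%N).
Proof.
rewrite !val_block; have [ii'|ii'|/val_inj ii'] := ltngtP i' i => /=.
- apply: leq_trans (leq_addr _ _); apply: leq_trans (leq_psum n ii').
  by rewrite psumS ltn_add2l.
- have /negbTE-> : i' != i by rewrite -val_eqE /= neq_ltn ii' orbT.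
  apply/negbTE; rewrite -leqNgt; apply: ltnW.
  apply: leq_trans (leq_addr _ _); apply: leq_trans (leq_psum n ii').
  by rewrite psumS ltn_add2l.
- by subst i'; rewrite eqxx ltn_add2l.
Qed.

Variable m : forall i : 'I_k, 'I_(n i) -> arity.

Let M (r : 'I_(asum n)) : arity := m (block_pos r).
Let A (i : 'I_k) : arity := asum (@m i).

Lemma asum_asum : asum M = asum A :> nat.
Proof.
rewrite /= big_block; apply: eq_bigr => i _; apply: eq_bigr => j _.
by apply: (@block_ind (fun i' j' => arity_nat (m j') = m j)).
Qed.

Lemma psum_block i (j : 'I_(n i)) :
  psum M (block j) = (psum A i + psum (@m i) j)%N.
Proof.
rewrite {1}/psum big_block /=.
rewrite (bigID (fun i' : 'I_k => (i' < i)%N))/=; congr (_ + _)%N.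
  apply: eq_bigr => i' ii'; apply: eq_big => [j'|j' _].
    by rewrite ltn_block ii'.
  by apply: (@block_ind (fun i'' j'' => arity_nat (m j'') = m j')).
rewrite (bigD1 i) ?ltnn//= [X in (_ + X)%N]big1 ?addn0.
  apply: eq_big => [j'|j' _]; first by rewrite ltn_block ltnn eqxx.
  by apply: (@block_ind (fun i'' j'' => arity_nat (m j'') = m j')).
move=> i' /andP[ii' i'i]; rewrite big_pred0// => j'.
by rewrite ltn_block (negPf ii') (negPf i'i).
Qed.

Lemma psum_psum (i : 'I_k) (a : nat) : (a <= n i)%N ->
  psum M (psum n i + a) = (psum A i + psum (@m i) a)%N.
Proof.
case: a => [_|a an].
  have := psum_block (tfirst (n i)); rewrite val_block /= addn0.
  by rewrite psum0.
pose j := Ordinal an; have := psumS M (block j); rewrite psum_block.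
rewrite val_block /= addnS => ->; rewrite -[in RHS]/(j.+1) psumS addnA.
congr (_ + _)%N.
by apply: (@block_ind (fun i'' j'' => arity_nat (m j'') = m j)).
Qed.

Lemma psum_psum0 (i : nat) : (i <= k)%N -> psum M (psum n i) = psum A i.
Proof.
rewrite leq_eqVlt => /orP[/eqP->|ik]; first by rewrite !psum_max asum_asum.
by have := @psum_psum (Ordinal ik) 0 isT; rewrite psum0 !addn0.
Qed.

End IteratedBlocks.

Lemma psum_unit (k : arity) (i : nat) :
  (i <= k)%N -> psum (fun _ : 'I_k => arity1) i = i.
Proof.
elim: i => [|i IH] ik; first by rewrite psum0.
by rewrite (psumS _ (Ordinal ik)) /= IH ?addn1// ltnW.
Qed.

Lemma arity_inj (N N' : arity) : N = N' :> nat -> N = N'.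
Proof. exact: val_inj. Qed.

Section EndomorphismOperadLaws.
Variables (K : fieldType) (d : Order.disp_t) (T : finPOrderType d).
Local Notation I := (incalg K T).
Local Notation upd x i u := (@dfwith _ (fun _ => I) x i u).
Local Notation E := (@endop K d T).

Lemma endop_existT (N N' : arity) (f : E N) (f' : E N') : N = N' :> nat ->
  (forall X : nat -> I,
    f (pure (fun i : 'I_N => X i)) = f' (pure (fun i : 'I_N' => X i))) ->
  existT E N f = existT E N' f'.
Proof.
move=> /arity_inj NN'; subst N' => ff'; congr existT.
apply: endop_ext => x.
pose X a : I := if insub a is Some i then x i else 0.
suff -> : x = fun i : 'I_N => X i by [].
by apply/funext => i; rewrite /X valK.
Qed.

Definition endop_unit_hom : 'Hom(tens K T arity1, I) :=
  linfun (tlift (fun x : 'I_arity1 -> I => x ord0)).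

Lemma endop_unit_pure x : endop_unit_hom (pure x) = x ord0.
Proof.
rewrite lfunE /=; apply: (tlift_pure x (F := fun x : 'I_arity1 -> I => x ord0)).
by move=> {}x i a u v; rewrite !updE (ord1 i).
Qed.

Fact endop_unit_subproof : endop_unit_hom \in @is_endop K d T arity1.
Proof.
apply/is_endopP; split=> [s x sS|i j x s].
  by rewrite !endop_unit_pure !updE (ord1 (tfirst arity1)) (ord1 (tlast arity1)).
by rewrite (ord1 i) (ord1 j).
Qed.
Definition endop_unit : E arity1 := EndOp endop_unit_subproof.

Lemma endop_comp_linearl (k : arity) (n : 'I_k -> arity)
  (g : forall i, E (n i)) : linear (fun f => endop_comp f g).
Proof.
move=> a f f'; apply: endop_ext => x; rewrite endop_compE.
by rewrite !(add_lfunE, scale_lfunE) !endop_compE.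
Qed.

Lemma endop_comp_linearr (k : arity) (n : 'I_k -> arity) (f : E k) :
  multilinear (V := fun i => E (n i)) (endop_comp f).
Proof.
move=> g i a u v; apply: endop_ext => x.
rewrite !(add_lfunE, scale_lfunE) !endop_compE.
pose y i := g i (pure (fun j => x (block j))).
have yE w : (fun i' => @dfwith _ (fun i => E (n i)) g i w i' (pure (fun j => x (block j)))) =
    upd y i (w (pure (fun j => x (block j)))).
  apply/funext => i'; rewrite updE /y.
  by case: dfwithP => [|j ij]; rewrite ?eqxx// eq_sym (negPf ij).
by rewrite !yE !(add_lfunE, scale_lfunE) pure_multilinear linearP.
Qed.

Lemma endop_compA (k : arity) (n : 'I_k -> arity)
    (m : forall i : 'I_k, 'I_(n i) -> arity) (f : E k)
    (g : forall i, E (n i)) (h : forall i j, E (m i j)) :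
  existT E _
    (endop_comp (endop_comp f g) (fun r => h (block_of r) (block_pos r))) =
  existT E _ (endop_comp f (fun i => endop_comp (g i) (h i))).
Proof.
apply: endop_existT => [|X]; first exact: asum_asum.
rewrite !endop_compE; congr (f (pure _)); apply/funext => i.
rewrite endop_compE; congr (g i (pure _)); apply/funext => j.
pose c := (psum (fun i => asum (m i)) i + psum (m i) j)%N.
transitivity (h _ (block_pos (block j)) (pure (fun l => X (c + l)%N))).
  by congr (h _ _ (pure _)); apply/funext => l; rewrite val_block psum_block.
transitivity (h i j (pure (fun l => X (c + l)%N))); last first.
  by congr (h _ _ (pure _)); apply/funext => l; rewrite !val_block addnA.
by apply: (@block_ind _ _ (fun i' j' =>
  h i' j' (pure (fun l => X (c + l)%N)) = h i j (pure (fun l => X (c + l)%N)))).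
Qed.

Lemma endop_comp1l (n : arity) (f : E n) :
  existT E _ (endop_comp endop_unit (fun _ : 'I_arity1 => f)) = existT E n f.
Proof.
apply: endop_existT => [|X]; first by rewrite /= big_ord1.
rewrite endop_compE endop_unit_pure; congr (f (pure _)); apply/funext => j.
by rewrite val_block psum0.
Qed.

Lemma endop_comp1r (k : arity) (f : E k) :
  existT E _ (endop_comp f (fun _ : 'I_k => endop_unit)) = existT E k f.
Proof.
apply: endop_existT => [|X]; first by rewrite /= sum1_card card_ord.
rewrite endop_compE; congr (f (pure _)); apply/funext => i.
by rewrite endop_unit_pure val_block psum_unit ?addn0// ltnW.
Qed.

Definition endop_operad : operad K :=
  @Operad K (fun n => E n : lmodType K) (@endop_comp K d T) endop_unit
    endop_comp_linearl endop_comp_linearr endop_compA endop_comp1l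
    endop_comp1r.

End EndomorphismOperadLaws.

Arguments endop_operad K {d} T.

Section CochainOperad.
Variables (K : fieldType) (d : Order.disp_t) (T : finPOrderType d).

Definition chain (n : nat) : Type :=
  {c : {ffun 'I_n.+1 -> T} |
    [forall i : 'I_n.+1, forall j : 'I_n.+1, (i <= j)%N ==> (c i <= c j)%O]}.
HB.instance Definition _ n := SubFinite.on (chain n).

Lemma chain_le n (c : chain n) (i j : 'I_n.+1) :
  (i <= j)%N -> (val c i <= val c j)%O.
Proof. by have /forallP/(_ i)/forallP/(_ j)/implyP := valP c. Qed.

Fact rechain_subproof m n (c : chain n) (h : 'I_m.+1 -> 'I_n.+1) :
  {homo h : i j / (i <= j)%N} ->
  [forall i : 'I_m.+1, forall j : 'I_m.+1,
    (i <= j)%N ==> ([ffun l => val c (h l)] i <= [ffun l => val c (h l)] j)%O].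
Proof.
move=> hh; apply/forallP => i; apply/forallP => j; apply/implyP => ij.
by rewrite !ffunE chain_le// hh.
Qed.

Definition rechain m n (c : chain n) (h : 'I_m.+1 -> 'I_n.+1)
    (hh : {homo h : i j / (i <= j)%N}) : chain m :=
  exist _ [ffun l => val c (h l)] (rechain_subproof c hh).

Section Subchains.
Variables (k : arity) (n : 'I_k -> arity).

Definition outer_index (i : 'I_k.+1) : 'I_(asum n).+1 := inord (psum n i).
Definition inner_index (i : 'I_k) (l : 'I_(n i).+1) : 'I_(asum n).+1 :=
  inord (psum n i + l).

Fact outer_index_homo : {homo outer_index : i j / (i <= j)%N}.
Proof.
move=> i j ij; rewrite !inordK ?ltnS -?psum_max ?leq_psum// -ltnS;
  exact: ltn_ord.
Qed.
Fact inner_index_homo i : {homo @inner_index i : l l' / (l <= l')%N}.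
Proof.
move=> l l' ll'; rewrite !inordK ?leq_add2l// ltnS psum_block_le// -ltnS;
  exact: ltn_ord.
Qed.

(* (c_0, c_{N_1}, ..., c_{N_k}) and (c_{N_i}, ..., c_{N_{i+1}}), i < k *)
Definition outer_chain (c : chain (asum n)) : chain k :=
  rechain c outer_index_homo.
Definition inner_chain (c : chain (asum n)) (i : 'I_k) : chain (n i) :=
  rechain c (@inner_index_homo i).
End Subchains.

Definition cochain (n : arity) : lmodType K := {ffun chain n -> K^o}.

Definition dual_cochain (n : arity) (c : chain n) : cochain n :=
  [ffun c' : chain n => (c' == c)%:R : K^o].

Definition cochain_comp (k : arity) (n : 'I_k -> arity) (f : cochain k)
    (g : forall i, cochain (n i)) : cochain (asum n) :=
  [ffun c : chain (asum n) =>
    f (outer_chain c) * \prod_(i < k) g i (inner_chain c i) : K^o].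

Definition cochain_unit : cochain arity1 :=
  \sum_(c : chain arity1) dual_cochain c.

Lemma cochain_unitE c : cochain_unit c = 1.
Proof.
rewrite sum_ffunE (bigD1 c)//= big1 ?addr0 => [|c' cc']; rewrite ffunE ?eqxx//.
by rewrite eq_sym (negPf cc').
Qed.

Fact mkchain_subproof (G : nat -> T) n :
  {homo G : i j / (i <= j)%N >-> (i <= j)%O} ->
  [forall i : 'I_n.+1, forall j : 'I_n.+1,
    (i <= j)%N ==> ([ffun l : 'I_n.+1 => G l] i <= [ffun l : 'I_n.+1 => G l] j)%O].
Proof.
move=> hG; apply/forallP => i; apply/forallP => j; apply/implyP => ij.
by rewrite !ffunE hG.
Qed.
Definition mkchain (G : nat -> T) (hG : {homo G : i j / (i <= j)%N >-> (i <= j)%O})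
    n : chain n :=
  exist _ [ffun l : 'I_n.+1 => G l] (mkchain_subproof n hG).

Lemma mkchain_eq G hG G' hG' n : (forall a, (a <= n)%N -> G a = G' a) ->
  @mkchain G hG n = @mkchain G' hG' n.
Proof.
move=> GG'; apply/val_inj/ffunP => i /=; rewrite !ffunE GG'//.
by rewrite -ltnS; exact: ltn_ord.
Qed.

Lemma cochain_existT (N N' : arity) (f : cochain N) (f' : cochain N') :
  N = N' :> nat ->
  (forall G hG, f (@mkchain G hG N) = f' (@mkchain G hG N')) ->
  existT cochain N f = existT cochain N' f'.
Proof.
move=> /arity_inj NN'; subst N' => ff'; congr existT; apply/ffunP => c.
pose G a := val c (inord (minn a N)).
have hG : {homo G : i j / (i <= j)%N >-> (i <= j)%O}.
  by move=> i j ij; apply: chain_le; rewrite !inordK; lia.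
suff -> : c = mkchain hG N by [].
apply/val_inj/ffunP => i /=; rewrite ffunE /G; congr (val c _).
by apply: ord_inj; rewrite inordK; have := ltn_ord i; lia.
Qed.

Section CompOnChains.
Variables (k : arity) (n : 'I_k -> arity) (G : nat -> T).
Hypothesis hG : {homo G : i j / (i <= j)%N >-> (i <= j)%O}.

Fact homo_psum : {homo (fun i => G (psum n i)) : i j / (i <= j)%N >-> (i <= j)%O}.
Proof. by move=> i j ij; apply/hG/leq_psum. Qed.
Fact homo_addn a : {homo (fun i => G (a + i)) : i j / (i <= j)%N >-> (i <= j)%O}.
Proof. by move=> i j ij; apply/hG; rewrite leq_add2l. Qed.

Lemma outer_mkchain : outer_chain (mkchain hG (asum n)) = mkchain homo_psum k.
Proof.
apply/val_inj/ffunP => i /=; rewrite !ffunE inordK//.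
by have := leq_psum n (ltn_ord i : (i <= k)%N); rewrite psum_max.
Qed.

Lemma inner_mkchain i : inner_chain (mkchain hG (asum n)) i =
  mkchain (homo_addn (psum n i)) (n i).
Proof.
apply/val_inj/ffunP => l /=; rewrite !ffunE inordK// ltnS psum_block_le//.
by rewrite -ltnS; exact: ltn_ord.
Qed.

Lemma cochain_compE (f : cochain k) (g : forall i, cochain (n i)) :
  cochain_comp f g (mkchain hG (asum n)) =
  f (mkchain homo_psum k) * \prod_i g i (mkchain (homo_addn (psum n i)) (n i)).
Proof.
rewrite ffunE outer_mkchain; congr (_ * _).
by apply: eq_bigr => i _; rewrite inner_mkchain.
Qed.
End CompOnChains.

Lemma cochain_comp_linearl (k : arity) (n : 'I_k -> arity)
  (g : forall i, cochain (n i)) : linear (fun f => cochain_comp f g).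
Proof.
move=> a f f'; apply/ffunP => c; rewrite !ffunE mulrDl; congr (_ + _).
exact: esym (mulrA _ _ _).
Qed.

Lemma cochain_comp_linearr (k : arity) (n : 'I_k -> arity) (f : cochain k) :
  multilinear (V := fun i => cochain (n i)) (cochain_comp f).
Proof.
move=> g i a u v; apply/ffunP => c; rewrite !ffunE.
have H w : \prod_(i' < k) @dfwith _ (fun i => cochain (n i)) g i w i' (inner_chain c i') =
    w (inner_chain c i) * \prod_(i' < k | i' != i) g i' (inner_chain c i').
  rewrite (bigD1 i)//= dfwith_in; congr (_ * _).
  by apply: eq_bigr => j ji; rewrite dfwith_out// eq_sym.
have Z (p q r : K) : p * ((a * q) * r) = a * (p * (q * r)).
  by rewrite -mulrA mulrCA.
by rewrite !H !ffunE mulrDl mulrDr; congr (_ + _); exact: Z.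
Qed.

Lemma cochain_compA (k : arity) (n : 'I_k -> arity)
    (m : forall i : 'I_k, 'I_(n i) -> arity) (f : cochain k)
    (g : forall i, cochain (n i)) (h : forall i j, cochain (m i j)) :
  existT cochain _
    (cochain_comp (cochain_comp f g) (fun r => h (block_of r) (block_pos r))) =
  existT cochain _ (cochain_comp f (fun i => cochain_comp (g i) (h i))).
Proof.
apply: cochain_existT => [|G hG]; first exact: asum_asum.
rewrite !cochain_compE -mulrA; congr (f _ * _).
  by apply: mkchain_eq => i ik; rewrite psum_psum0.
rewrite big_block -big_split/=; apply: eq_bigr => i _.
rewrite cochain_compE; congr (g i _ * _).
  by apply: mkchain_eq => a an; rewrite psum_psum.
apply: eq_bigr => j _.
pose hG' := homo_addn hG (psum (fun i => asum (m i)) i + psum (m i) j)%N.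
transitivity (h _ (block_pos (block j)) (mkchain hG' _)).
  by congr (h _ _ _); apply: mkchain_eq => a _; rewrite psum_block.
transitivity (h i j (mkchain hG' _)); last first.
  by congr (h _ _ _); apply: mkchain_eq => a _; rewrite addnA.
by apply: (@block_ind _ _ (fun i' j' =>
  h i' j' (mkchain hG' _) = h i j (mkchain hG' _))).
Qed.

Lemma cochain_comp1l (n : arity) (f : cochain n) :
  existT cochain _ (cochain_comp cochain_unit (fun _ : 'I_arity1 => f)) =
  existT cochain n f.
Proof.
apply: cochain_existT => [|G hG]; first by rewrite /= big_ord1.
rewrite cochain_compE cochain_unitE mul1r big_ord1; congr (f _).
by apply: mkchain_eq => a _; rewrite psum0.
Qed.

Lemma cochain_comp1r (k : arity) (f : cochain k) :
  existT cochain _ (cochain_comp f (fun _ : 'I_k => cochain_unit)) =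
  existT cochain k f.
Proof.
apply: cochain_existT => [|G hG]; first by rewrite /= sum1_card card_ord.
rewrite cochain_compE big1 ?mulr1 => [|i _]; last exact: cochain_unitE.
by congr (f _); apply: mkchain_eq => a ak; rewrite psum_unit.
Qed.

Definition cochain_operad : operad K :=
  @Operad K cochain cochain_comp cochain_unit
    cochain_comp_linearl cochain_comp_linearr cochain_compA cochain_comp1l
    cochain_comp1r.

End CochainOperad.

Arguments chain {d} T n.
Arguments cochain_operad K {d} T.
Arguments dual_cochain K {d T n} c.

Section Mu.
Variables (K : fieldType) (d : Order.disp_t) (T : finPOrderType d) (n : arity).
Local Notation I := (incalg K T).
Local Notation upd x i u := (@dfwith _ (fun _ => I) x i u).

Fact ends_le (c : chain T n) : (val c ord0 <= val c ord_max)%O.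
Proof. exact: chain_le. Qed.
Definition ends (c : chain T n) : interval T := mkinterval (ends_le c).

(* For the basis tensor b = (beta_0, beta_1) (x) (beta_1', beta_2) (x) ...
   (x) (beta_{n-1}', beta_n): beta_l = beta_l' for 0 < l < n, and
   (beta_0, ..., beta_n) = c. *)
Definition mu_support (c : chain T n) (b : {ffun 'I_n -> interval T}) : bool :=
  [&& [forall i : 'I_n, forall j : 'I_n,
         (j == i.+1 :> nat) ==> ((val (b i)).2 == (val (b j)).1)],
      (val (b (tfirst n))).1 == val c ord0 &
      [forall i : 'I_n, (val (b i)).2 == val c (lift ord0 i)]].

Definition mu_hom (c : chain T n) : 'Hom(tens K T n, I) :=
  linfun (tbase_lift (fun b => if mu_support c b then ibase K (ends c) else 0)).

Fact steps_le (c : chain T n) (i : 'I_n) :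
  (val c (widen_ord (leqnSn n) i) <= val c (lift ord0 i))%O.
Proof. by apply: chain_le; rewrite /= /bump; lia. Qed.
Definition steps (c : chain T n) : {ffun 'I_n -> interval T} :=
  [ffun i : 'I_n => mkinterval (steps_le c i)].

Lemma mu_supportE c b : mu_support c b = (b == steps c).
Proof.
apply/idP/eqP => [/and3P[/forallP bb /eqP b0 /forallP bS]|->]; last first.
  apply/and3P; split.
  - apply/forallP => i; apply/forallP => j; apply/implyP => /eqP ij.
    by rewrite !ffunE /=; apply/eqP; congr (val c _); apply: ord_inj.
  - by rewrite ffunE /=; apply/eqP; congr (val c _); apply: ord_inj.
  - by apply/forallP => i; rewrite ffunE.
apply/ffunP => j; apply/val_inj; rewrite ffunE /=.
rewrite [LHS]surjective_pairing (eqP (bS j)); congr (_, _).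
have [j0|j0] := posnP j.
  have -> : j = tfirst n by apply: ord_inj.
  by rewrite b0; congr (val c _); apply: ord_inj.
have j1 : (j.-1 < n)%N by have := ltn_ord j; lia.
have /forallP/(_ j)/implyP := bb (Ordinal j1); rewrite /= prednK// eqxx.
move=> /(_ isT)/eqP <-; rewrite (eqP (bS _)); congr (val c _).
by apply: ord_inj; rewrite /= /bump /=; lia.
Qed.

Lemma mu_homE c t : mu_hom c t = t (steps c) *: ibase K (ends c).
Proof.
rewrite lfunE /= /tbase_lift (bigD1 (steps c))//= mu_supportE eqxx.
rewrite big1 ?addr0// => b bc; by rewrite mu_supportE (negPf bc) scaler0.
Qed.

Lemma diag_mull s p : s \in diagalg K T ->
  s * ibase K p = icoef s (val p).1 (val p).1 *: ibase K p.
Proof.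
move=> sS; apply: icoefP => a b; rewrite mul_diagl// icoefZ icoef_base.
by case: eqP => [->|]//; rewrite !mulr0.
Qed.

Lemma diag_mulr s p : s \in diagalg K T ->
  ibase K p * s = icoef s (val p).2 (val p).2 *: ibase K p.
Proof.
move=> sS; apply: icoefP => a b; rewrite mul_diagr// icoefZ icoef_base mulrC.
by case: eqP => [->|]//; rewrite !mulr0.
Qed.

Lemma pure_mull (x : 'I_n -> I) i s b : s \in diagalg K T ->
  pure (upd x i (s * x i)) b = icoef s (val (b i)).1 (val (b i)).1 * pure x b.
Proof.
move=> sS; rewrite pure_upd icoef_val mul_diagl// -mulrA -icoef_val.
by congr (_ * _); rewrite ffunE [RHS](bigD1 i).
Qed.

Lemma pure_mulr (x : 'I_n -> I) i s b : s \in diagalg K T ->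
  pure (upd x i (x i * s)) b = icoef s (val (b i)).2 (val (b i)).2 * pure x b.
Proof.
move=> sS; rewrite pure_upd icoef_val mul_diagr// -icoef_val -mulrA mulrCA.
by congr (_ * _); rewrite ffunE [RHS](bigD1 i).
Qed.

Fact mu_subproof c : mu_hom c \in @is_endop K d T n.
Proof.
have stepsP i : (val (steps c i)).1 = val c (widen_ord (leqnSn n) i) /\
    (val (steps c i)).2 = val c (lift ord0 i) by rewrite ffunE.
apply/is_endopP; split=> [s x sS|i j x s ij sS]; rewrite !mu_homE.
  rewrite pure_mull// pure_mulr// -incalg_scaleAl -incalg_scaleAr.
  rewrite diag_mull// diag_mulr// !scalerA.
  split; rewrite mulrC; congr (_ * icoef s _ _ *: _); rewrite ?(stepsP _).1 ?(stepsP _).2;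
    congr (val c _); apply: ord_inj => //=; rewrite /bump /=;
    by have := arity_gt0 n; lia.
rewrite pure_mull// pure_mulr//; congr (icoef s _ _ * _ *: _);
  rewrite (stepsP i).2 (stepsP j).1; congr (val c _); apply: ord_inj;
  by rewrite /= ij.
Qed.
Definition mu (c : chain T n) : endop K T n := EndOp (mu_subproof c).

End Mu.

Arguments mu K {d T n} c.

(* Main.v *)
From HB Require Import structures.
Require Import Defs.
From mathcomp Require Import all_boot all_order all_algebra.
From mathcomp Require Import boolp zify.

(** The basis tensors of the n-th tensor power of the incidence algebra are
indexed by the n-tuples of intervals.  Call such a tuple composable when each
interval ends where the next one starts.  The composable tuples are exactly the
tuples of consecutive steps of a chain with n + 1 terms (composable_steps), and
the chain is determined by them (steps_inj).

A map in the endomorphism operad is rigid on these tensors, because S contains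
the idempotents (s, s).  If two neighbours do not match at a vertex, moving the
idempotent of that vertex across the tensor sign kills the tensor
(endop_pbase0); on the steps of a chain c, multiplying by the idempotents of the
two extremities of c forces the value to be a multiple of (c_0, c_n)
(endop_pbase_steps).  So the map is given by one scalar per chain, freely
chosen since mu_c realises the indicator function of c: this is the linear
bijection mu_lift, with inverse steps_coef.

Because elements of the endomorphism operad are determined by their values on
steps (endop_steps_ext), compatibility with compositions needs to be tested on
the steps of one long chain only.  There each inner map multiplies by its value
on a subchain and returns the interval between the extremities of that subchain;
these intervals are the steps of the outer chain, on which the outer map
multiplies by its own value.  The product of these scalars is the composition
of cochains. *)

Set Implicit Arguments.
Unset Strict Implicit.
Unset Printing Implicit Defensive.

Import Order.TTheory GRing.Theory.
Local Open Scope ring_scope.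

(** The inverse of an arity-wise bijective morphism is automatically linear and
compatible with compositions and units: apply the morphism and cancel. *)
Lemma bijective_operad_morphism_iso (K : fieldType) (P Q : operad K)
    (phi : operad_morphism P Q) (psi : forall n : arity, Q n -> P n) :
  (forall n, cancel (phi n) (psi n)) -> (forall n, cancel (psi n) (phi n)) ->
  operad_isomorphism phi.
Proof.
move=> phiK psiK.
have psi_linear n : linear (psi n).
  by move=> a u v; apply: (can_inj (phiK n)); rewrite linearP !psiK.
pose psiM n := GRing.isLinear.Build K (Q n) (P n) *:%R (psi n) (psi_linear n).
pose psiL n : {linear Q n -> P n} := HB.pack (psi n) (psiM n).
have psi_comp (k : arity) (n : 'I_k -> arity) (f : Q k) (g : forall i, Q (n i)) :
    psiL (asum n) (op_comp f g) = op_comp (psiL k f) (fun i => psiL (n i) (g i)).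
  apply: (can_inj (phiK (asum n))); rewrite opm_comp /= !psiK.
  by congr op_comp; apply: functional_extensionality_dep => i; rewrite psiK.
have psi_unit : psiL arity1 (op_unit Q) = op_unit P.
  by apply: (can_inj (phiK arity1)); rewrite opm_unit /= psiK.
exists (OperadMorphism psi_comp psi_unit) => n.
by split; [exact: phiK|exact: psiK].
Qed.

(** * Basis tensors and diagonal idempotents *)

Section ChainTensors.
Variables (K : fieldType) (d : Order.disp_t) (T : finPOrderType d).
Local Notation I := (incalg K T).
Local Notation interval := Defs.interval.
Local Notation upd x i u := (@dfwith _ (fun _ => I) x i u).

Lemma pure_upd0 n (x : 'I_n -> I) i : pure (upd x i 0) = 0.
Proof. by apply/ffunP => b; rewrite pure_upd !ffunE mul0r. Qed.

Lemma pure_scale n (a : 'I_n -> K) (x : 'I_n -> I) :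
  pure (fun i => a i *: x i) = (\prod_i a i) *: pure x.
Proof.
apply/ffunP => b; rewrite !ffunE.
under eq_bigr do rewrite ffunE.
exact: big_split.
Qed.

Definition pbase n (b : {ffun 'I_n -> interval T}) : tens K T n :=
  pure (fun i => ibase K (b i)).

Lemma pbaseE n (b b' : {ffun 'I_n -> interval T}) : pbase b b' = (b' == b)%:R.
Proof.
rewrite ffunE; case: eqP => [->|bb'].
  by rewrite big1 // => i _; rewrite ffunE eqxx.
have /fintype.forallPn[i bi] : ~~ [forall i, b' i == b i].
  by apply/negP => /eqfunP /ffunP.
by rewrite (bigD1 i) //= ffunE (negPf bi) mul0r.
Qed.

Lemma pbase_expand n (t : tens K T n) : t = \sum_b t b *: pbase b.
Proof.
apply/ffunP => c.
have zE b : (t b *: pbase b) c = t b * (c == b)%:R by rewrite -pbaseE ffunE.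
rewrite sum_ffunE (bigD1 c) //= big1 => [|b bc].
  by rewrite zE eqxx addr0 mulr1.
by rewrite zE eq_sym (negPf bc) mulr0.
Qed.

Definition diag_idem (s : T) : I := ibase K (mkinterval (lexx s)).

Lemma diag_idem_in s : diag_idem s \in diagalg K T.
Proof. by apply/memv_span/map_f; rewrite mem_enum. Qed.

Lemma icoef_diag_idem s a : icoef (diag_idem s) a a = (s == a)%:R.
Proof. by rewrite icoef_base /= xpair_eqE andbb. Qed.

(** * Rigidity of bimodule maps on chains *)

Section Arity.
Variable n : arity.

(** The chain is made of the start of the first interval followed by the ends
of all the intervals. *)
Lemma composable_steps (b : {ffun 'I_n -> interval T}) :
  (forall i j : 'I_n, j = i.+1 :> nat -> (val (b i)).2 = (val (b j)).1) ->
  exists c : chain T n, b = steps c.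
Proof.
move=> bb.
(* capping the index at n - 1 makes G constant from n on, hence monotone on
   all of nat *)
pose G a := if a is a'.+1 then (val (b (insubd (tfirst n) (minn a' n.-1)))).2
            else (val (b (tfirst n))).1.
have n0 := arity_gt0 n.
have hG : {homo G : i j / (i <= j)%N >-> (i <= j)%O}.
  apply: homo_leq => [i|i j k|[|a]]; [exact: lexx|exact: le_trans| |].
    rewrite /G; have -> : insubd (tfirst n) (minn 0 n.-1) = tfirst n.
      by apply: ord_inj; rewrite val_insubd /=; case: ifP => _; lia.
    exact: valP (b _).
  rewrite /G; have [an|an] := ltnP a.+1 n; last first.
    by have -> : minn a n.-1 = minn a.+1 n.-1 by lia.
  rewrite (bb _ (insubd (tfirst n) (minn a.+1 n.-1))); first exact: valP (b _).
  by rewrite !val_insubd; do 2 case: ifP; lia.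
exists (mkchain hG n); apply/eqP; rewrite -mu_supportE; apply/and3P; split.
- by apply/forallP => i; apply/forallP => j; apply/implyP => /eqP/bb->.
- by rewrite /= ffunE.
- apply/forallP => i; rewrite /= ffunE /=.
  suff -> : insubd (tfirst n) (minn i n.-1) = i by [].
  apply: ord_inj; rewrite val_insubd; have := ltn_ord i; case: ifP; lia.
Qed.

(** At a mismatch between the intervals i and j = i + 1, the idempotent of the
end of interval i fixes interval i on its right and annihilates interval j on
its left; balancing identifies the two resulting tensors. *)
Lemma endop_pbase0 (g : endop K T n) (b : {ffun 'I_n -> interval T}) :
  (forall c : chain T n, b != steps c) -> g (pbase b) = 0.
Proof.
move=> bN; have [i [j [ij bij]]] : exists i j : 'I_n,
    j = i.+1 :> nat /\ (val (b i)).2 != (val (b j)).1.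
  apply: contrapT => H; have [|c bc] := @composable_steps b; last first.
    by have /eqP := bN c.
  by move=> i j ij; apply/eqP/negPn/negP => bij; apply: H; exists i, j.
pose x i := ibase K (b i).
have sS := diag_idem_in (val (b i)).2.
have := endop_bal g x ij sS.
rewrite (diag_mull _ sS) icoef_diag_idem (negPf bij) scale0r pure_upd0 linear0.
rewrite (diag_mulr _ sS) icoef_diag_idem eqxx scale1r => <-.
by congr (g (pure _)); apply/funext => l; rewrite updE; case: eqP => [->|].
Qed.

Lemma steps_first (c : chain T n) :
  (val (steps c (tfirst n))).1 = val c ord0.
Proof. by rewrite ffunE /=; congr (val c _); apply: ord_inj. Qed.

Lemma steps_last (c : chain T n) :
  (val (steps c (tlast n))).2 = val c ord_max.
Proof.
rewrite ffunE /=; congr (val c _); apply: ord_inj => /=.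
by rewrite /bump /=; have := arity_gt0 n; lia.
Qed.

(** The tensor of the steps of c is fixed by the idempotent of its start on the
left and by that of its end on the right; bimodule maps transport this to the
value, which therefore lies on the line of the interval from start to end. *)
Lemma endop_pbase_steps (g : endop K T n) (c : chain T n) :
  g (pbase (steps c)) = g (pbase (steps c)) (ends c) *: ibase K (ends c).
Proof.
set y := g _.
have y_idl : y = diag_idem (val c ord0) * y.
  rewrite -(endop_mul g _ (diag_idem_in _)).1; congr (g (pure _)).
  apply/funext => i; rewrite updE; case: eqP => // ->.
  by rewrite (diag_mull _ (diag_idem_in _)) icoef_diag_idem steps_first eqxx scale1r.
have y_idr : y = y * diag_idem (val c ord_max).
  rewrite -(endop_mul g _ (diag_idem_in _)).2; congr (g (pure _)).
  apply/funext => i; rewrite updE; case: eqP => // ->.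
  by rewrite (diag_mulr _ (diag_idem_in _)) icoef_diag_idem steps_last eqxx scale1r.
apply: icoefP => a b; rewrite icoefZ icoef_base icoef_val /=.
case: eqP => [[-> ->]|ab]; first by rewrite mulr1.
rewrite mulr0; have [ac|ac] := eqVneq (val c ord0) a; last first.
  by rewrite y_idl mul_diagl ?diag_idem_in // icoef_diag_idem (negPf ac) mul0r.
have [bc|bc] := eqVneq (val c ord_max) b; first by case: ab; rewrite ac bc.
by rewrite y_idr mul_diagr ?diag_idem_in // icoef_diag_idem (negPf bc) mulr0.
Qed.

(** By linearity basis tensors suffice, and every map vanishes on those that are
not composable. *)
Lemma endop_steps_ext (g h : endop K T n) :
  (forall c : chain T n, g (pbase (steps c)) = h (pbase (steps c))) -> g = h.
Proof.
move=> gh; apply/val_inj/lfunP => t; rewrite (pbase_expand t) !linear_sum.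
apply: eq_bigr => b _; rewrite !linearZ; congr (_ *: _).
have [[c ->]|bN] := pselect (exists c : chain T n, b = steps c); first exact: gh.
have {}bN c : b != steps c by apply/eqP => bc; apply: bN; exists c.
exact: etrans (endop_pbase0 g bN) (esym (endop_pbase0 h bN)).
Qed.

Lemma steps_inj : injective (@steps d T n).
Proof.
move=> c c' cc'; apply/val_inj/ffunP => i.
case: (unliftP ord0 i) => [j ->|->]; last by rewrite -!steps_first cc'.
by have := congr1 (fun b : {ffun _ -> _} => (val (b j)).2) cc'; rewrite !ffunE.
Qed.

(** * The linear bijection *)

Definition mu_lift (f : cochain K T n) : endop K T n :=
  \sum_c (f c : K) *: mu K c.

Lemma mu_lift_linear : linear mu_lift.
Proof.
move=> a f f'; rewrite /mu_lift scaler_sumr -big_split.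
by apply: eq_bigr => c _; rewrite !ffunE scalerDl scalerA.
Qed.
HB.instance Definition _ := GRing.isLinear.Build K (cochain K T n)
  (endop K T n) *:%R mu_lift mu_lift_linear.

Lemma mu_lift_dual (c : chain T n) : mu_lift (dual_cochain K c) = mu K c.
Proof.
rewrite /mu_lift (bigD1 c) //= big1 => [|c' cc']; rewrite ffunE.
  by rewrite eqxx scale1r addr0.
by rewrite (negPf cc') scale0r.
Qed.

(** Of all the summands f c' mu_c', only c' = c is nonzero on the steps of c. *)
Lemma mu_lift_pbase f (c : chain T n) :
  mu_lift f (pbase (steps c)) = f c *: ibase K (ends c).
Proof.
pose ev (g : endop K T n) := g (pbase (steps c)).
rewrite -/(ev _) /mu_lift (@big_morph _ _ ev 0 +%R 0 +%R); first last.
- by rewrite /ev /= zero_lfunE.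
- by move=> g h; rewrite /ev /= add_lfunE.
have evE c' : ev ((f c' : K) *: mu K c') = (f c' * (c' == c)%:R : K) *: ibase K (ends c').
  rewrite /ev /= scale_lfunE mu_homE pbaseE scalerA.
  by rewrite (inj_eq steps_inj).
under eq_bigr do rewrite evE.
rewrite (bigD1 c) //= big1 => [|c' cc']; first by rewrite eqxx mulr1 addr0.
by rewrite (negPf cc') mulr0 scale0r.
Qed.

Definition steps_coef (g : endop K T n) : cochain K T n :=
  [ffun c => g (pbase (steps c)) (ends c)].

Lemma mu_liftK : cancel mu_lift steps_coef.
Proof.
move=> f; apply/ffunP => c; rewrite ffunE mu_lift_pbase !ffunE eqxx.
exact: mulr1.
Qed.

Lemma steps_coefK : cancel steps_coef mu_lift.
Proof.
move=> g; apply: endop_steps_ext => c.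
by rewrite mu_lift_pbase ffunE -endop_pbase_steps.
Qed.

End Arity.

(** * Compatibility with compositions *)

Section Composition.
Variables (k : arity) (n : 'I_k -> arity) (c : chain T (asum n)).

(** Cutting the steps of c into blocks gives the steps of the inner chains, and
the extremities of the inner chains are the steps of the outer one: these two
identities match composition of maps with composition of cochains. *)
Lemma steps_block i (j : 'I_(n i)) :
  steps c (block j) = steps (inner_chain c i) j.
Proof.
apply/val_inj; rewrite !ffunE /= !ffunE; congr (val c _, val c _);
  apply: ord_inj; rewrite /inner_index [RHS]inordK ?ltnS ?psum_block_le //.
- exact: val_block.
- exact: ltnW (ltn_ord j).
- by rewrite /= /bump /= addnCA; congr S; exact: val_block.
- exact: ltn_ord j.
Qed.

Lemma ends_inner i : ends (inner_chain c i) = steps (outer_chain c) i.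
Proof.
apply/val_inj; rewrite !ffunE /= !ffunE; congr (val c _, val c _);
  apply: ord_inj; rewrite /inner_index /outer_index /=.
  by rewrite addn0.
by rewrite /bump /= add1n psumS.
Qed.

Lemma ends_outer : ends (outer_chain c) = ends c.
Proof.
apply/val_inj; rewrite /= !ffunE; congr (val c _, val c _);
  apply: ord_inj; rewrite /outer_index /=; first by rewrite psum0 inordK.
by rewrite psum_max inordK.
Qed.

End Composition.

Lemma mu_lift_comp (k : arity) (n : 'I_k -> arity) (f : cochain K T k)
    (g : forall i, cochain K T (n i)) :
  mu_lift (cochain_comp f g) =
  endop_comp (mu_lift f) (fun i => mu_lift (g i)).
Proof.
apply: endop_steps_ext => c; rewrite mu_lift_pbase endop_compE.
have inner i : mu_lift (g i) (pure (fun j => ibase K (steps c (block j)))) =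
    g i (inner_chain c i) *: ibase K (steps (outer_chain c) i).
  rewrite -ends_inner -mu_lift_pbase; congr (mu_lift _ (pure _)).
  by apply/funext => j; rewrite steps_block.
under [X in pure X]funext do rewrite inner.
rewrite pure_scale linearZ -/(pbase (steps (outer_chain c))) /= mu_lift_pbase.
by rewrite scalerA ends_outer ffunE mulrC.
Qed.

Lemma mu_lift_unit : mu_lift (cochain_unit K T) = endop_unit K T.
Proof.
apply: endop_steps_ext => c; rewrite mu_lift_pbase cochain_unitE scale1r.
rewrite endop_unit_pure; congr (ibase K _); apply/val_inj; rewrite ffunE /=.
by congr (val c _, val c _); apply: ord_inj.
Qed.

End ChainTensors.

Theorem theorem5p8 (K : fieldType) (d : Order.disp_t) (T : finPOrderType d) :
  exists phi : operad_morphism (cochain_operad K T) (endop_operad K T),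
    (forall (n : arity) (c : chain T n), phi n (dual_cochain K c) = mu K c) /\
    operad_isomorphism phi.
Proof.
pose phi := @OperadMorphism K (cochain_operad K T) (endop_operad K T)
  (fun n => @mu_lift K d T n) (@mu_lift_comp K d T) (mu_lift_unit K T).
exists phi; split; first exact: mu_lift_dual.
exact: (@bijective_operad_morphism_iso _ _ _ phi (@steps_coef K d T)
  (@mu_liftK K d T) (@steps_coefK K d T)).
Qed.
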